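(* Let $\lambda_a,\lambda_b>0$ and let $a,b$ be independent real random variables with probability densities $g_a(x)=\frac{\lambda_a}{2}e^{-\lambda_a|x|}$ and $g_b(x)=\frac{\lambda_b}{2}e^{-\lambda_b|x|}$. Let $S=2\sqrt{a^2+b^2}$ be the level spacing of the real symmetric random matrix $\begin{pmatrix} a & b\\ b & -a\end{pmatrix}$. Then $S$ has the probability density $$P(S)=\frac{\lambda_a\lambda_b}{4}\,S\int_0^{\pi/2}\exp\!\left(-\frac{S}{2}(\lambda_a\cos\varphi+\lambda_b\sin\varphi)\right)d\varphi,\qquad S>0.$$ As $S\to0^+$ one has $P(S)/S\to\frac{\pi\lambda_a\lambda_b}{8}$. Moreover, with $\phi=\arctan(\lambda_a/\lambda_b)$ and $\hat A=\sqrt{\lambda_a^2+\lambda_b^2}$, for every $S>0$ there is $\chi_0(S)\in[\phi,\phi+\pi/2]$ such that $$P(S)=\frac{\pi\lambda_a\lambda_b}{8}\,S\,\exp\!\left(-\frac{S}{2}\,\hat A\,\sin\chi_0(S)\right).$$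
   Context: The matrix $\begin{pmatrix} a & b\\ b & -a\end{pmatrix}$ has real eigenvalues $\pm\sqrt{a^2+b^2}$; the level spacing is the difference of the two eigenvalues. *)

(* Defs.v *)
From HB Require Import structures.
From mathcomp Require Import all_boot all_order all_algebra.
From mathcomp Require Import all_classical all_reals all_analysis.
Set Implicit Arguments.
Unset Strict Implicit.
Unset Printing Implicit Defensive.
Import Order.TTheory GRing.Theory Num.Theory.
Import numFieldNormedType.Exports.
Local Open Scope classical_set_scope.
Local Open Scope ring_scope.

Definition has_density d (T : measurableType d) (R : realType)
    (P : probability T R) (X : T -> R) (f : R -> R) : Prop :=
  [/\ measurable_fun setT X,
      measurable_fun setT f,
      (forall x, 0 <= f x) &
      forall A : set R, measurable A ->
        P (X @^-1` A) = (\int[lebesgue_measure]_(x in A) (f x)%:E)%E].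

(* For measurable X and Y, the product rule over all Borel sets. *)
Definition independent2 d (T : measurableType d) (R : realType)
    (P : probability T R) (X Y : T -> R) : Prop :=
  forall A B : set R, measurable A -> measurable B ->
    P (X @^-1` A `&` Y @^-1` B) = (P (X @^-1` A) * P (Y @^-1` B))%E.

Definition laplace_density (R : realType) (l x : R) : R :=
  l / 2 * expR (- l * `|x|).

(* The matrix (a, b; b, -a). *)
Definition sym_mx (R : realType) (a b : R) : 'M[R]_2 :=
  \matrix_(i < 2, j < 2)
    (if i != j then b else if i == ord0 then a else - a).

(* s is the larger minus the smaller eigenvalue of the 2 x 2 matrix M, whose
   eigenvalues are real; s = 0 when they coincide. *)
Definition is_level_spacing (R : realType) (M : 'M[R]_2) (s : R) : Prop :=
  exists l1 l2 : R,
    [/\ l1 <= l2,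
        (forall x : R, eigenvalue M x = (x == l1) || (x == l2)) &
        s = l2 - l1].

(* The closed formula for P(s); it is the density of the spacing for s > 0
   only, and is negative for s < 0. *)
Definition spacing_formula (R : realType) (la lb s : R) : R :=
  la * lb / 4 * s *
  \int[lebesgue_measure]_(t in `[0, pi / 2])
     expR (- (s / 2) * (la * cos t + lb * sin t)).

Definition spacing_density (R : realType) (la lb s : R) : R :=
  if 0 < s then spacing_formula la lb s else 0.

(* Main.v *)
(* Writing y = x t and x = u / sqrt(1 + t^2), two linear substitutions and
   Tonelli turn the integral of the product density over the plane into one over
   (u, t) in which the level spacing 2 |u| does not depend on t.  The inner
   integral over t is the angular integral, through t = tan(theta).  The limit
   and the closed form with chi_0 both come from the mean value theorem for this
   integral, since la cos(t) + lb sin(t) = Ahat sin(t + phi). *)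
Require Import Defs.
From HB Require Import structures.
From mathcomp Require Import all_boot all_order all_algebra.
From mathcomp Require Import all_classical all_reals all_analysis.
From mathcomp Require Import measurable_realfun ring lra.
Set Implicit Arguments.
Unset Strict Implicit.
Unset Printing Implicit Defensive.
Import Order.TTheory GRing.Theory Num.Theory.
Import numFieldNormedType.Exports.
Local Open Scope classical_set_scope.
Local Open Scope ring_scope.

(** * Eigenvalues and level spacing of the matrix *)

(** The trace is zero and the determinant is [- (a^2 + b^2)], so the characteristic polynomial is
    [X^2 - (a^2 + b^2)]. *)
Lemma eigenvalue_sym_mx (R : realType) (a b x : R) :
  eigenvalue (sym_mx a b) x = (x ^+ 2 == a ^+ 2 + b ^+ 2).
Proof.
rewrite eigenvalue_root_char /root /char_poly (expand_det_row _ ord0).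
rewrite !big_ord_recl big_ord0 /cofactor !det_mx11 !mxE/= !hornerE/=.
by rewrite -[RHS]subr_eq0; congr (_ == 0); ring.
Qed.

Lemma is_level_spacing_sym_mx (R : realType) (a b : R) :
  is_level_spacing (sym_mx a b) (2 * Num.sqrt (a ^+ 2 + b ^+ 2)).
Proof.
set r := Num.sqrt _.
have r2 : a ^+ 2 + b ^+ 2 = r ^+ 2 by rewrite sqr_sqrtr// addr_ge0// sqr_ge0.
exists (- r), r; split; last by ring.
- by have := sqrtr_ge0 (a ^+ 2 + b ^+ 2); rewrite -/r; lra.
- by move=> x; rewrite eigenvalue_sym_mx r2 eqf_sqr orbC.
Qed.

(** * The angular exponent as a single sine wave *)

Lemma cos_atan_gt0 (R : realType) (x : R) : 0 < cos (atan x).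
Proof. by apply: cos_gt0_pihalf; rewrite atan_gtNpi2 atan_ltpi2. Qed.

Lemma sin_atan_cos (R : realType) (x : R) : sin (atan x) = x * cos (atan x).
Proof.
transitivity (tan (atan x) * cos (atan x)); last by rewrite atanK.
by rewrite /tan mulfVK// gt_eqF// cos_atan_gt0.
Qed.

Definition angular_exponent {R : realType} (la lb t : R) : R :=
  la * cos t + lb * sin t.

Lemma continuous_angular_exponent (R : realType) (la lb : R) :
  continuous (angular_exponent la lb).
Proof.
move=> t; apply: cvgD; apply: cvgM; first exact: cvg_cst.
- exact: continuous_cos.
- exact: cvg_cst.
- exact: continuous_sin.
Qed.

(** This is the addition formula for the sine: with [phi = atan (la / lb)] and [Ahat] the square
    root, [la = Ahat sin phi] and [lb = Ahat cos phi]. Positivity of [lb] gives the root its sign in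
    the second equation. *)
Lemma angular_exponentE (R : realType) (la lb t : R) : 0 < lb ->
  angular_exponent la lb t =
  Num.sqrt (la ^+ 2 + lb ^+ 2) * sin (t + atan (la / lb)).
Proof.
move=> lb0; rewrite sinD.
have c0 := cos_atan_gt0 (la / lb); rewrite sin_atan_cos.
have -> : Num.sqrt (la ^+ 2 + lb ^+ 2) = lb / cos (atan (la / lb)).
  rewrite cos_atan invrK -[X in X * _](gtr0_norm lb0) -sqrtr_sqr.
  rewrite -sqrtrM ?sqr_ge0//; congr Num.sqrt.
  rewrite exprMn exprVn mulrDr mulr1 mulrCA divff ?expf_neq0 ?gt_eqF//.
  by rewrite mulr1 addrC.
rewrite /angular_exponent; field.
by rewrite !gt_eqF.
Qed.

(** * The mean value theorem for integrals *)

(** The average of [f] lies between its minimum and its maximum, both attained on the compact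
    segment, so the intermediate value theorem between the two extremal points yields [c]. *)
Lemma integral_mean_value (R : realType) (f : R -> R) (a b : R) : a < b ->
  continuous f ->
  exists2 c, c \in `[a, b] &
    \int[lebesgue_measure]_(t in `[a, b]) f t = (b - a) * f c.
Proof.
move=> ab cf.
have cfab : {within `[a, b], continuous f} by exact: continuous_subspaceT.
have intf : lebesgue_measure.-integrable `[a, b] (EFin \o f).
  by apply: continuous_compact_integrable => //; exact: segment_compact.
have intk k :
    lebesgue_measure.-integrable `[a, b] (EFin \o cst k : R -> \bar R).
  apply: continuous_compact_integrable; first exact: segment_compact.
  by apply: continuous_subspaceT => x; exact: cvg_cst.
have intkE k :
    \int[lebesgue_measure]_(t in `[a, b]) (cst k t : R) = k * (b - a).
  by rewrite Rintegral_cst//= lebesgue_measure_itv/= lte_fin ab -EFinB.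
have ba : 0 < b - a by rewrite subr_gt0.
have [M Mab fM] := EVT_max (ltW ab) cfab.
have [m mab fm] := EVT_min (ltW ab) cfab.
set I := \int[lebesgue_measure]_(t in `[a, b]) f t.
have IM : I <= f M * (b - a).
  by rewrite -intkE; apply: le_Rintegral => // x ?; exact: fM.
have Im : f m * (b - a) <= I.
  by rewrite -intkE; apply: le_Rintegral => // x ?; exact: fm.
have vP : f m <= I / (b - a) <= f M.
  by rewrite ler_pdivlMr// Im ler_pdivrMr.
have sub x y : x \in `[a, b] -> y \in `[a, b] -> `[x, y] `<=` `[a, b].
  by rewrite !in_itv/= => /andP[? _] /andP[_ ?]; exact: subset_itv.
suff [c cab fc] : exists2 c, c \in `[a, b] & f c = I / (b - a).
  by exists c => //; rewrite fc mulrC mulfVK ?gt_eqF.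
(* The minimum may be attained before or after the maximum, and the intermediate value theorem needs
   ordered endpoints. *)
have [mM|/ltW Mm] := leP m M.
- have [||c cmM fc] := @IVT _ f m M (I / (b - a)) mM.
  + exact: continuous_subspaceT.
  + by case/andP: vP => v1 v2; rewrite ge_min le_max v1 v2 orbT.
  + by exists c => //; exact: (sub _ _ mab Mab).
- have [||c cmM fc] := @IVT _ f M m (I / (b - a)) Mm.
  + exact: continuous_subspaceT.
  + by case/andP: vP => v1 v2; rewrite ge_min le_max v1 v2 orbT.
  + by exists c => //; exact: (sub _ _ Mab mab).
Qed.

(** * Linear substitutions on the real line *)

Lemma ge0_integral_oppr (R : realType) (f : R -> \bar R) :
  measurable_fun [set: R] f -> (forall x, 0 <= f x)%E ->
  (\int[lebesgue_measure]_x f (- x)%R = \int[lebesgue_measure]_x f x)%E.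
Proof.
move=> mf f0.
have mN : measurable_fun setT (-%R : measurableTypeR R -> measurableTypeR R).
  exact: oppr_measurable.
transitivity (\int[pushforward lebesgue_measure
    (-%R : measurableTypeR R -> measurableTypeR R)]_x f x)%E.
  by rewrite ge0_integral_pushforward.
by apply: eq_measure_integral => A mA _; exact: lebesgue_measureN.
Qed.

(** The image under [x |-> c x] of [c] times Lebesgue measure is Lebesgue measure again; the
    substitution is then integration against an image measure. *)
Lemma ge0_integral_scale_gt0 (R : realType) (c : R) (f : R -> \bar R) : 0 < c ->
  measurable_fun [set: R] f -> (forall x, 0 <= f x)%E ->
  (c%:E * \int[lebesgue_measure]_x f (c * x)%R
    = \int[lebesgue_measure]_x f x)%E.
Proof.
move=> c0 mf f0.
pose phi := fun x : measurableTypeR R => c * x : measurableTypeR R.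
have mphi : measurable_fun setT phi by exact: mulrl_measurable.
pose k := NngNum (ltW c0).
transitivity (\int[mscale k lebesgue_measure]_x (f \o phi) x)%E.
  rewrite ge0_integral_mscale//; last by move=> x _; exact: f0.
  by apply: measurableT_comp; [exact: mf|exact: mulrl_measurable].
transitivity (\int[pushforward (mscale k lebesgue_measure) phi]_x f x)%E.
  by rewrite ge0_integral_pushforward.
apply: eq_measure_integral => A mA _.
(* By uniqueness it suffices to compare half-open intervals: the preimage of []a, b]] has length
   [(b - a) / c], and the factor [c] restores [b - a]. *)
apply/esym/lebesgue_measure_unique => //= _ [[a b]] _ <-.
rewrite /pushforward /mscale/=.
rewrite (_ : _ @^-1` _ = `]a / c, b / c]%classic); last first.
  apply/seteqP; split => x /=; rewrite !in_itv/= /phi;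
    by rewrite ltr_pdivrMr// ler_pdivlMr// ![x * c]mulrC.
rewrite !lebesgue_measure_itv/= !lte_fin ltr_pM2r ?invr_gt0//.
case: ifPn => _; last by rewrite mule0.
by rewrite -!EFinB -EFinM -mulrBl mulrC mulfVK// gt_eqF.
Qed.

Lemma ge0_integral_scale (R : realType) (c : R) (f : R -> \bar R) : c != 0 ->
  measurable_fun [set: R] f -> (forall x, 0 <= f x)%E ->
  (`|c|%:E * \int[lebesgue_measure]_x f (c * x)%R
    = \int[lebesgue_measure]_x f x)%E.
Proof.
move=> c0 mf f0; have [c_lt0|c_gt0|] := ltgtP c 0; last by move/eqP: c0.
  (* A negative factor is treated as a reflection combined with the scaling by [- c]. *)
  rewrite ltr0_norm// -(ge0_integral_oppr mf f0).
  rewrite -[RHS](@ge0_integral_scale_gt0 _ (- c))//.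
  - by under [in RHS]eq_integral do rewrite mulNr opprK.
  - by rewrite oppr_gt0.
  - by apply: measurableT_comp => //; exact: oppr_measurable.
by rewrite gtr0_norm// ge0_integral_scale_gt0.
Qed.

(** * Polar coordinates by two linear substitutions *)

Section polar_coordinates.
Context {R : realType}.
Local Notation mu := (@lebesgue_measure R).
Local Notation Rm := (measurableTypeR R).

Lemma continuous_sqrt_1Dsqr_inv :
  continuous (fun t : R => (Num.sqrt (1 + t ^+ 2))^-1).
Proof.
move=> t; apply: cvgV.
  by rewrite gt_eqF// sqrtr_gt0 ltr_pwDl// sqr_ge0.
apply: continuous_comp; last exact: sqrt_continuous.
by apply: cvgD; [exact: cvg_cst|exact: exprn_continuous].
Qed.

(* Polar coordinates with a signed radius [u] and the slope [t = y / x], the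
   tangent of the polar angle, in place of the angle itself. *)
Lemma ge0_integral_polar (f : R * R -> \bar R) :
  measurable_fun [set: R * R] f -> (forall z, 0 <= f z)%E ->
  (\int[mu]_x \int[mu]_y f (x, y) =
   \int[mu]_u \int[mu]_t
     ((`|u| / (1 + t ^+ 2))%:E *
      f (u / Num.sqrt (1 + t ^+ 2), u / Num.sqrt (1 + t ^+ 2) * t)%R))%E.
Proof.
move=> mf f0.
have mfx x : measurable_fun [set: R] (fun y => f (x, y)).
  exact: measurableT_comp.
have mfg (g1 g2 : R * R -> R) : measurable_fun [set: R * R] g1 ->
    measurable_fun [set: R * R] g2 ->
    measurable_fun [set: R * R] (fun z => f (g1 z, g2 z)).
  by move=> *; apply: measurableT_comp => //; exact: measurable_fun_pair.
(* [k t] is the cosine of the angle [atan t], so that [x = u * k t]; its square is the factor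
   [1 / (1 + t^2)] of the Jacobian. *)
pose k (t : R) := (Num.sqrt (1 + t ^+ 2))^-1.
have k0 t : 0 < k t.
  by rewrite invr_gt0 sqrtr_gt0 ltr_pwDl// sqr_ge0.
have k2 t : k t * k t = (1 + t ^+ 2)^-1.
  by rewrite -invfM -expr2 sqr_sqrtr// addr_ge0// sqr_ge0.
have mk : measurable_fun [set: R] k.
  exact: (continuous_measurable_fun continuous_sqrt_1Dsqr_inv).
have m1 : measurable_fun [set: R * R] (fun z => z.1 : R).
  exact: measurable_fst.
have m2 : measurable_fun [set: R * R] (fun z => z.2 : R).
  exact: measurable_snd.
(* The integrand after [y = x t], with Jacobian [|x|]. *)
pose g (z : Rm * Rm) : \bar R := (`|z.1|%:E * f (z.1, z.1 * z.2)%R)%E.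
have mg : measurable_fun setT g.
  apply: emeasurable_funM; last first.
    by apply: mfg => //; exact: measurable_funM.
  apply/measurable_EFinP; exact: (measurableT_comp (@normr_measurable R setT)).
have g0 z : (0 <= g z)%E by rewrite mule_ge0.
(* The integrand after the further substitution [x = u * k t]: one factor [k t] comes from [dx], the
   other from [|x|]. *)
pose h (z : Rm * Rm) : \bar R :=
  ((`|z.1| / (1 + z.2 ^+ 2))%:E * f (z.1 * k z.2, z.1 * k z.2 * z.2)%R)%E.
have mh : measurable_fun setT h.
  have mk2 : measurable_fun [set: R * R] (fun z => k z.2 : R).
    exact: (measurableT_comp mk m2).
  apply: emeasurable_funM; last first.
    by apply: mfg; repeat (apply: measurable_funM => //).
  apply/measurable_EFinP; apply: measurable_funM.
    exact: (measurableT_comp (@normr_measurable R setT)).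
  have -> : (fun z : R * R => (1 + z.2 ^+ 2)^-1) = (fun z => k z.2 * k z.2).
    by apply/funext => z; rewrite k2.
  exact: measurable_funM.
have h0 z : (0 <= h z)%E.
  by rewrite mule_ge0// lee_fin divr_ge0// addr_ge0// sqr_ge0.
transitivity (\int[mu]_x \int[mu]_t g (x, t))%E.
  apply: ae_eq_integral => //.
  - exact: (measurable_fun_fubini_tonelli_F (m2 := mu) (f : Rm * Rm -> \bar R)).
  - exact: (measurable_fun_fubini_tonelli_F (m2 := mu) g).
  (* At [x = 0] the substitution [y = x t] degenerates and the inner integrals may differ, but a
     single point is negligible. *)
  exists [set 0]; split => //; first exact: lebesgue_measure_set1.
  move=> x /=; apply: contra_notP => /eqP x0 _.
  rewrite -(ge0_integral_scale x0)// -ge0_integralZl//.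
  exact: (measurableT_comp (mfx x) (mulrl_measurable x)).
(* Exchanging the integrals fixes [t], which makes [x = u * k t] a linear substitution in [x]
   alone. *)
transitivity (\int[mu]_t \int[mu]_x g (x, t))%E.
  exact: (fubini_tonelli (m1 := mu) (m2 := mu) g mg g0).
transitivity (\int[mu]_t \int[mu]_u h (u, t))%E; last first.
  exact/esym/(fubini_tonelli (m1 := mu) (m2 := mu) h mh h0).
apply: eq_integral => t _.
have mgt : measurable_fun [set: R] (fun x => g (x, t)).
  exact: measurableT_comp.
rewrite -(ge0_integral_scale (lt0r_neq0 (k0 t)))//.
rewrite -ge0_integralZl//; last first.
  exact: (measurableT_comp mgt (mulrl_measurable (k t))).
apply: eq_integral => u _; rewrite /g/= muleA -EFinM /h/=.
rewrite [k t * u]mulrC; congr (_%:E * _)%E.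
by rewrite normrM mulrCA (gtr0_norm (k0 t)) k2.
Qed.

End polar_coordinates.

(** * The joint law of two independent variables with densities *)

(** The joint law and the measure with density [f x * g y] both take the value [PX A * PY B] on
    every rectangle, so each equals the product measure of the two marginal laws. *)
Lemma joint_density d (T : measurableType d) (R : realType)
    (P : probability T R) (X Y : {RV P >-> R}) (f g : R -> R) :
  has_density P X f -> has_density P Y g -> independent2 P X Y ->
  forall C : set (measurableTypeR R * measurableTypeR R), measurable C ->
  P ((fun w => (X w, Y w)) @^-1` C) =
  (\int[lebesgue_measure]_x \int[lebesgue_measure]_y
      (\1_C (x, y) * (f x * g y))%:E)%E.
Proof.
move=> [mX mf f0 Xf] [mY mg g0 Yg] indep C mC.
pose mu : {sigma_finite_measure set (measurableTypeR R) -> \bar R} :=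
  @lebesgue_measure R.
pose h := fun z : measurableTypeR R * measurableTypeR R => (f z.1 * g z.2)%:E.
have mh : measurable_fun setT h.
  apply/measurable_EFinP/measurable_funM.
  - exact: (measurableT_comp mf measurable_fst).
  - exact: (measurableT_comp mg measurable_snd).
have h0 z : (0 <= h z)%E by rewrite lee_fin mulr_ge0.
have mXY : measurable_fun setT
    (fun w => (X w, Y w) : measurableTypeR R * measurableTypeR R).
  exact: measurable_fun_pair.
pose nuf A := (\int[mu \x mu]_(z in A) h z)%E.
have nuf0 : nuf set0 = 0%E by exact: integral_set0.
have nuf_ge0 A : (0 <= nuf A)%E by exact: integral_ge0.
pose nu : {measure set (measurableTypeR R * measurableTypeR R) -> \bar R} :=
  HB.pack nuf (isMeasure.Build _ _ _ nuf nuf0 nuf_ge0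
    (semi_sigma_additive_nng_induced mh h0)).
have mX' : measurable_fun setT (X : T -> measurableTypeR R) by exact: mX.
have mY' : measurable_fun setT (Y : T -> measurableTypeR R) by exact: mY.
pose X' : {mfun T >-> measurableTypeR R} :=
  HB.pack (X : T -> measurableTypeR R) (isMeasurableFun.Build _ _ _ _ _ mX').
pose Y' : {mfun T >-> measurableTypeR R} :=
  HB.pack (Y : T -> measurableTypeR R) (isMeasurableFun.Build _ _ _ _ _ mY').
pose PX : probability (measurableTypeR R) R := distribution P X'.
pose PY : probability (measurableTypeR R) R := distribution P Y'.
(* Over a rectangle the restricted density is a function of [x] times a function of [y], so the
   iterated integral given by Tonelli factors. *)
have nuE A B : measurable A -> measurable B -> nu (A `*` B) = (PX A * PY B)%E.
  move=> mA mB.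
  rewrite /nu/= /nuf integral_mkcond fubini_tonelli1//; last 2 first.
  - apply/(measurable_restrictT _ _).1 => //; first exact: measurableX.
    exact: measurable_funTS.
  - by move=> z; exact: erestrict_ge0.
  have mfA : measurable_fun setT ((EFin \o f : measurableTypeR R -> _) \_ A).
    apply/(measurable_restrictT _ _).1 => //.
    by apply/measurable_EFinP; exact: measurable_funTS.
  have mgB : measurable_fun setT ((EFin \o g : measurableTypeR R -> _) \_ B).
    apply/(measurable_restrictT _ _).1 => //.
    by apply/measurable_EFinP; exact: measurable_funTS.
  have fA0 x : (0 <= ((EFin \o f) \_ A) x)%E.
    by apply: erestrict_ge0 => y _; rewrite lee_fin.
  have gB0 x : (0 <= ((EFin \o g) \_ B) x)%E.
    by apply: erestrict_ge0 => y _; rewrite lee_fin.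
  transitivity (\int[mu]_x (((EFin \o f) \_ A) x * PY B))%E.
    apply: eq_integral => x _; rewrite /fubini_F.
    transitivity (\int[mu]_y
        (((EFin \o f) \_ A) x * ((EFin \o g) \_ B) y))%E.
      apply: eq_integral => y _; rewrite !patchE in_setX.
      by case: (x \in A) => /=; case: (y \in B); rewrite ?mule0 ?mul0e.
    rewrite ge0_integralZl// -integral_mkcond; congr (_ * _)%E.
    by rewrite -[RHS]/(P (Y @^-1` B)) Yg.
  rewrite ge0_integralZr// -integral_mkcond; congr (_ * _)%E.
  by rewrite -[RHS]/(P (X @^-1` A)) Xf.
pose XY : {mfun T >-> (measurableTypeR R * measurableTypeR R)%type} :=
  HB.pack (fun w => (X w, Y w)) (isMeasurableFun.Build _ _ _ _ _ mXY).
pose PXY : probability (measurableTypeR R * measurableTypeR R)%type R :=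
  distribution P XY.
have PXYE A B : measurable A -> measurable B -> PXY (A `*` B) = (PX A * PY B)%E.
  by move=> mA mB; exact: indep.
have E1 := product_measure_unique PXYE mC.
have E2 := product_measure_unique nuE mC.
transitivity (PXY C); first by [].
rewrite -E1 E2.
transitivity (\int[mu \x mu]_z (h \_ C) z)%E; first exact: integral_mkcond.
have mhC : measurable_fun setT (h \_ C).
  by apply/(measurable_restrictT _ _).1 => //; exact: measurable_funTS.
have hC0 z : (0 <= (h \_ C) z)%E by exact: erestrict_ge0.
transitivity (\int[mu]_x \int[mu]_y (h \_ C) (x, y))%E.
  exact: (fubini_tonelli1 (m1 := mu) (m2 := mu) (h \_ C) mhC hC0).
apply: eq_integral => x _; apply: eq_integral => y _.
by rewrite epatch_indic/= muleC -EFinM.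
Qed.

(** * The substitution by the arctangent, and even integrands *)

Section atan_substitution.
Context {R : realType}.
Local Notation mu := (@lebesgue_measure R).

(** If [F] is a primitive of [G], then [F \o atan] is a primitive of the integrand on the left and
    tends to [F (pi / 2)] at infinity; the fundamental theorem on the half-line gives
    [F (pi / 2) - F 0]. *)
Lemma ge0_integral_atan (G : R -> R) :
  (forall x, 0 <= G x) -> continuous G ->
  (\int[mu]_(t in `[0%R, +oo[) (G (atan t) / (1 + t ^+ 2))%:E =
   (\int[mu]_(x in `[0, pi / 2]) G x)%:E)%E.
Proof.
move=> G0 cG.
have pi2 : 0 < pi / 2 :> R by rewrite divr_gt0// pi_gt0.
have intG (a b : R) : mu.-integrable `[a, b] (EFin \o G).
  apply: continuous_compact_integrable; first exact: segment_compact.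
  exact: continuous_subspaceT.
(* Starting the primitive at -1 makes it differentiable at 0. *)
pose F (x : R) := (\int[mu]_(t in `[-1, x]) G t)%R.
have dF (x : R) : -1 < x -> derivable F x 1 /\ derive1 F x = G x.
  move=> x1; apply: (@continuous_FTC1_closed _ _ _ _ (x + 1)) => //.
  - by rewrite ltrDl.
  - exact: cG.
have cF (x : R) : -1 < x -> {for x, continuous F}.
  move=> /dF[dFx _]; apply: differentiable_continuous.
  exact/derivable1_diffP.
have atan_gtN1 (t : R) : 0 <= t -> -1 < atan t.
  move=> t0; rewrite (@lt_le_trans _ _ 0)// ?ltrN10//.
  by rewrite -[X in X <= _](@atan0 R); exact: le_atan.
have dFa (t : R) : 0 <= t ->
    is_derive t 1 (F \o atan) (G (atan t) / (1 + t ^+ 2)).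
  move=> t0; have [dFt dFE] := dF _ (atan_gtN1 _ t0).
  have h1 : is_derive (atan t) 1 F (G (atan t)).
    by rewrite -dFE derive1E; exact: derivableP.
  exact: (is_derive1_comp h1 (is_derive1_atan t)).
rewrite (@ge0_continuous_FTC2y _ (fun t => G (atan t) / (1 + t ^+ 2))
  (F \o atan) 0 (F (pi / 2))).
- rewrite /= atan0 -EFinB; congr EFin.
  (* The difference of primitives is the integral over []0, pi / 2]]; adding the endpoint 0 does not
     change it. *)
  rewrite /F Rintegral_itvB//; last 2 first.
  + by rewrite bnd_simp lerN10.
  + by rewrite bnd_simp ltW.
  rewrite /Rintegral; congr fine; apply: integral_itv_obnd_cbnd.
  apply: measurable_funTS; apply/measurable_EFinP.
  exact: continuous_measurable_fun.
- by move=> t _; rewrite divr_ge0// addr_ge0// sqr_ge0.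
- apply: continuous_subspaceT => t; apply: cvgM.
    by apply: continuous_comp; [exact: continuous_atan|exact: cG].
  apply: cvgV; first by rewrite gt_eqF// ltr_pwDl// sqr_ge0.
  by apply: cvgD; [exact: cvg_cst|exact: exprn_continuous].
- apply: (cvg_comp _ _ (@cvgy_atan R)).
  by apply: cF; rewrite (lt_trans _ pi2)// ltrN10.
- by move=> t /ltW t0; have /@ex_derive := dFa _ t0.
- apply: cvg_at_right_filter; apply: continuous_comp.
    exact: continuous_atan.
  by apply: cF; exact: atan_gtN1.
- move=> t; rewrite in_itv/= andbT => /ltW t0.
  by rewrite derive1E; have /@derive_val := dFa _ t0.
Qed.

Lemma ge0_integral_even (f : R -> \bar R) :
  measurable_fun [set: R] f -> (forall x, 0 <= f x)%E ->
  (forall x, f (- x) = f x) ->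
  (\int[mu]_x f x = 2%:E * \int[mu]_(x in `[0%R, +oo[) f x)%E.
Proof.
move=> mf f0 fN.
have -> : (\int[mu]_x f x =
    \int[mu]_(x in `]-oo, 0%R[) f x + \int[mu]_(x in `[0%R, +oo[) f x)%E.
  rewrite -ge0_integral_setU//.
  - by congr (integral _ _ _); rewrite -setCitvr setUC setUv.
  - exact: measurable_funS mf.
  - by rewrite -setCitvr disj_set2E setICl.
rewrite integral_itv_bndo_bndc; last exact: measurable_funS mf.
have -> : (\int[mu]_(x in `]-oo, 0%R]) f x = \int[mu]_(x in `[0%R, +oo[) f x)%E.
  by rewrite ge0_integration_by_substitution0//; apply: eq_integral => x _.
by rewrite mule_natl mule2n.
Qed.

End atan_substitution.

(** * The density of the level spacing *)

Section level_spacing.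
Context {R : realType}.
Local Notation mu := (@lebesgue_measure R).
Variables la lb : R.
Hypotheses (la_gt0 : 0 < la) (lb_gt0 : 0 < lb).

Definition angular_weight (s t : R) : R :=
  expR (- (s / 2) * angular_exponent la lb t).

Lemma continuous_angular_weight s : continuous (angular_weight s).
Proof.
move=> t; apply: continuous_comp; last exact: continuous_expR.
by apply: cvgM; [exact: cvg_cst|exact: continuous_angular_exponent].
Qed.

Definition angular_integral (s : R) : R :=
  \int[mu]_(t in `[0, pi / 2]) angular_weight s t.

Lemma angular_integral_ge0 s : 0 <= angular_integral s.
Proof. by apply: Rintegral_ge0 => t _; exact: expR_ge0. Qed.

Lemma spacing_formulaE s :
  spacing_formula la lb s = la * lb / 4 * s * angular_integral s.
Proof. by []. Qed.

(** Extended by zero outside the angular range, the weight is a nonnegative measurable function on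
    the plane, so Tonelli makes its partial integral measurable in the parameter. *)
Lemma measurable_angular_integral : measurable_fun [set: R] angular_integral.
Proof.
pose q (z : measurableTypeR R * measurableTypeR R) : \bar R :=
  (angular_weight z.1 z.2 * \1_(`[0, pi / 2]%classic) z.2)%:E.
have m1 : measurable_fun [set: R * R] (fun z => z.1 : R).
  exact: measurable_fst.
have m2 : measurable_fun [set: R * R] (fun z => z.2 : R).
  exact: measurable_snd.
have mq : measurable_fun setT q.
  apply/measurable_EFinP/measurable_funM; last first.
    by apply: (measurableT_comp _ m2); exact: measurable_indic.
  apply: (measurableT_comp (@measurable_expR R)); apply: measurable_funM.
    apply: (measurableT_comp (@oppr_measurable R setT)).
    exact: (measurableT_comp (@mulrr_measurable R setT 2^-1) m1).
  apply: (measurableT_comp _ m2).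
  exact: (continuous_measurable_fun (@continuous_angular_exponent R la lb)).
have q0 z : (0 <= q z)%E by rewrite lee_fin mulr_ge0// ?expR_ge0.
have -> : angular_integral = fine \o (fun s => \int[mu]_t q (s, t))%E.
  apply/funext => s; rewrite /angular_integral /Rintegral integral_mkcond/=.
  by congr fine; apply: eq_integral => t _; rewrite epatch_indic.
apply: measurableT_comp; first exact: fine_measurable.
exact: (measurable_fun_fubini_tonelli_F (m2 := mu) q).
Qed.

Lemma spacing_density_ge0 (s : R) : 0 <= spacing_density la lb s.
Proof.
rewrite /spacing_density; case: ifPn => // s0.
rewrite spacing_formulaE mulr_ge0 ?angular_integral_ge0//.
by rewrite !mulr_ge0// ltW.
Qed.

Lemma measurable_spacing_density :
  measurable_fun [set: R] (spacing_density la lb).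
Proof.
have -> : spacing_density la lb =
    (fun s => la * lb / 4 * s * angular_integral s * \1_(`]0, +oo[%classic) s).
  apply/funext => s; rewrite /spacing_density indicE.
  case: ifPn => s0; last first.
    by rewrite memNset ?mulr0//= in_itv/= andbT; exact/negP.
  by rewrite mem_set ?mulr1//= in_itv/= s0.
apply: measurable_funM; last exact: measurable_indic.
apply: measurable_funM; last exact: measurable_angular_integral.
exact: mulrl_measurable.
Qed.

(** At [u = 0] the default value 0 of the density agrees with the vanishing factor [|u|], so one
    formula serves every real [u]. *)
Lemma spacing_density_norm (u : R) : spacing_density la lb (2 * `|u|) =
  2 * (`|u| * (la * lb / 4)) * angular_integral (2 * `|u|).
Proof.
rewrite /spacing_density; case: ifPn => u0.
  by rewrite spacing_formulaE; congr (_ * _); ring.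
have -> : `|u| = 0 by apply/eqP; rewrite eq_le normr_ge0 andbT; move: u0; lra.
by rewrite mul0r mulr0 mul0r.
Qed.

(** This is the inner polar integral at fixed signed radius [u]. It is twice the integral over
    [t >= 0], and those slopes correspond to the angles from 0 to [pi / 2]; the factor 2 turns [|u|]
    into the spacing [2 |u|]. *)
Lemma integral_angular_density (u : R) :
  (\int[mu]_t (`|u| / (1 + t ^+ 2) *
     (laplace_density la (u / Num.sqrt (1 + t ^+ 2)) *
      laplace_density lb (u / Num.sqrt (1 + t ^+ 2) * t)))%:E =
   (spacing_density la lb (2 * `|u|))%:E)%E.
Proof.
have t1 (t : R) : 0 < 1 + t ^+ 2 by rewrite ltr_pwDl// sqr_ge0.
set h := (X in (\int[mu]_t X t)%E).
(* Merging the two exponentials leaves an expression in [|t|] and [t^2] only, hence even in [t]. *)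
pose h' (t : R) : R := `|u| * (la * lb / 4) *
  (expR (- `|u| * ((la + lb * `|t|) * (Num.sqrt (1 + t ^+ 2))^-1)) /
   (1 + t ^+ 2)).
have hE t : h t = (h' t)%:E.
  rewrite /h /h' /laplace_density !normrM normfV (ger0_norm (sqrtr_ge0 _)).
  congr EFin; set k := (Num.sqrt _)^-1.
  set A := expR (- la * _); set B := expR (- lb * _).
  have -> : expR (- `|u| * ((la + lb * `|t|) * k)) = A * B.
    by rewrite -expRD; congr expR; ring.
  by field; rewrite gt_eqF.
have h0 t : (0 <= h t)%E.
  by rewrite hE lee_fin !mulr_ge0// ?expR_ge0 ?invr_ge0 ?ltW.
have mh : measurable_fun [set: R] h.
  rewrite (_ : h = EFin \o h'); last exact/funext.
  apply/measurable_EFinP; apply: continuous_measurable_fun => t.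
  apply: cvgM; first exact: cvg_cst.
  apply: cvgM; last first.
    apply: cvgV; first by rewrite gt_eqF.
    by apply: cvgD; [exact: cvg_cst|exact: exprn_continuous].
  apply: continuous_comp; last exact: continuous_expR.
  apply: cvgM; first exact: cvg_cst.
  apply: cvgM; last exact: continuous_sqrt_1Dsqr_inv.
  apply: cvgD; first exact: cvg_cst.
  by apply: cvgM; [exact: cvg_cst|exact: norm_continuous].
rewrite (ge0_integral_even mh h0); last first.
  by move=> t; rewrite !hE /h' normrN sqrrN.
(* For [t >= 0], [(la + lb t) / sqrt (1 + t^2)] is the angular exponent at [atan t], because the
   cosine there is [1 / sqrt (1 + t^2)] and the sine is [t] times it. *)
transitivity (2%:E * \int[mu]_(t in `[0%R, +oo[) ((`|u| * (la * lb / 4))%:E *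
    (angular_weight (2 * `|u|) (atan t) / (1 + t ^+ 2))%:E))%E.
  congr (_ * _)%E; apply: eq_integral => t; rewrite inE/= in_itv/= andbT => t0.
  rewrite hE -EFinM.
  congr (_ * (expR _ / _))%:E.
  rewrite /angular_exponent sin_atan_cos cos_atan (ger0_norm t0).
  by field; rewrite gt_eqF// sqrtr_gt0.
rewrite ge0_integralZl_EFin//; last 3 first.
- by move=> t _; rewrite lee_fin divr_ge0// ?expR_ge0 ?ltW.
- apply/measurable_funTS/measurable_EFinP.
  apply: continuous_measurable_fun => t; apply: cvgM.
    apply: continuous_comp; first exact: continuous_atan.
    exact: continuous_angular_weight.
  apply: cvgV; first by rewrite gt_eqF.
  by apply: cvgD; [exact: cvg_cst|exact: exprn_continuous].
- by rewrite !mulr_ge0// ltW.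
rewrite ge0_integral_atan; last 2 first.
- by move=> x; exact: expR_ge0.
- exact: continuous_angular_weight.
by rewrite spacing_density_norm -!EFinM; congr EFin; exact: mulrA.
Qed.

(** Both signs of [u] give the same spacing [s = 2 |u|], and the resulting factor 2 is the one in
    [ds = 2 du]. *)
Lemma integral_spacing_density (A : set R) : measurable A ->
  (\int[mu]_u (\1_A (2 * `|u|) * spacing_density la lb (2 * `|u|))%:E =
   \int[mu]_(s in A) (spacing_density la lb s)%:E)%E.
Proof.
move=> mA.
pose H (s : R) : \bar R := (\1_A s * spacing_density la lb s)%:E.
have mH : measurable_fun [set: R] H.
  apply/measurable_EFinP/measurable_funM; first exact: measurable_indic.
  exact: measurable_spacing_density.
have H0 s : (0 <= H s)%E by rewrite lee_fin mulr_ge0// spacing_density_ge0.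
have mH2 : measurable_fun [set: R] (fun u => H (2 * `|u|)).
  apply: (measurableT_comp mH).
  apply: (measurableT_comp (@mulrl_measurable R setT 2)).
  exact: normr_measurable.
transitivity (\int[mu]_u H (2 * `|u|)%R)%E; first by [].
have H20 (u : R) : (0 <= H (2 * `|u|)%R)%E by exact: H0.
have H2N (u : R) : H (2 * `|- u|) = H (2 * `|u|) by rewrite normrN.
rewrite (ge0_integral_even mH2 H20 H2N).
transitivity (2%:E * \int[mu]_u H (2 * u)%R)%E; last first.
  rewrite ge0_integral_scale_gt0// [RHS]integral_mkcond.
  by apply: eq_integral => s _; rewrite epatch_indic/= muleC.
(* The density is 0 at negative arguments, so the integral over the half-line extends to the whole
   line. *)
rewrite integral_mkcond; congr (_ * _)%E; apply: eq_integral => u _.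
rewrite patchE; have [u0|u0] := leP 0 u.
  by rewrite mem_set ?ger0_norm//= in_itv/= u0.
rewrite memNset/=; last by rewrite in_itv/= andbT leNgt u0.
by rewrite /H /spacing_density ifF ?mulr0//; apply/negbTE; rewrite -leNgt; lra.
Qed.

(** The event is the preimage of a Borel set of the plane under the pair; its probability is
    computed from the joint density in polar coordinates, integrating first over the slope and then
    over the radius. *)
Lemma level_spacing_has_density d (T : measurableType d) (P : probability T R)
    (a b : {RV P >-> R}) :
  independent2 P a b ->
  has_density P a (laplace_density la) ->
  has_density P b (laplace_density lb) ->
  has_density P (fun w => 2 * Num.sqrt (a w ^+ 2 + b w ^+ 2))
    (spacing_density la lb).
Proof.
move=> ab Pa Pb.
pose r (z : R * R) : R := 2 * Num.sqrt (z.1 ^+ 2 + z.2 ^+ 2).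
have mr : measurable_fun [set: R * R] r.
  apply: (measurableT_comp (@mulrl_measurable R setT 2)).
  apply: (measurableT_comp (continuous_measurable_fun (@sqrt_continuous R))).
  by apply: measurable_funD; apply: measurable_funX;
    [exact: measurable_fst|exact: measurable_snd].
have [ma mla la0 _] := Pa; have [mb mlb lb0 _] := Pb.
split.
- exact: (measurableT_comp mr (measurable_fun_pair ma mb)).
- exact: measurable_spacing_density.
- exact: spacing_density_ge0.
move=> A mA.
have mrA : measurable (r @^-1` A).
  by rewrite -[X in measurable X]setTI; exact: mr.
transitivity (P ((fun w => (a w, b w)) @^-1` (r @^-1` A))); first by [].
rewrite (joint_density Pa Pb ab)//.
pose f (z : R * R) : \bar R :=
  (\1_(r @^-1` A) z * (laplace_density la z.1 * laplace_density lb z.2))%:E.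
have mf : measurable_fun [set: R * R] f.
  apply/measurable_EFinP/measurable_funM; first exact: measurable_indic.
  apply: measurable_funM.
    exact: (measurableT_comp mla measurable_fst).
  exact: (measurableT_comp mlb measurable_snd).
have f0 z : (0 <= f z)%E.
  by rewrite lee_fin; apply: mulr_ge0 => //; exact: mulr_ge0.
transitivity (\int[mu]_x \int[mu]_y f (x, y))%E.
  by apply: eq_integral => x _; apply: eq_integral => y _.
rewrite (ge0_integral_polar mf f0) -integral_spacing_density//.
apply: eq_integral => u _.
(* The point with signed radius [u] lies at distance [|u|] from the origin whatever its slope, so
   the indicator of the event is constant in the inner integral. *)
have rE (t : R) :
    r (u / Num.sqrt (1 + t ^+ 2), u / Num.sqrt (1 + t ^+ 2) * t) = 2 * `|u|.
  have t1 : 0 < 1 + t ^+ 2 by rewrite ltr_pwDl// sqr_ge0.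
  rewrite /r/= -(sqrtr_sqr u); congr (2 * Num.sqrt _).
  by rewrite !exprMn exprVn sqr_sqrtr ?ltW//; field; rewrite gt_eqF.
have fE (t : R) : f (u / Num.sqrt (1 + t ^+ 2), u / Num.sqrt (1 + t ^+ 2) * t) =
    (\1_A (2 * `|u|) * (laplace_density la (u / Num.sqrt (1 + t ^+ 2)) *
       laplace_density lb (u / Num.sqrt (1 + t ^+ 2) * t)))%:E.
  by rewrite /f -(rE t) !indicE; congr (_%:R * _)%:E; congr nat_of_bool;
    apply/idP/idP; rewrite !inE.
under eq_integral do rewrite fE -EFinM mulrCA.
rewrite indicE; case: (_ \in A).
  rewrite mul1r -integral_angular_density.
  by apply: eq_integral => t _; rewrite mul1r.
by rewrite mul0r integral0_eq// => t _; rewrite mul0r.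
Qed.

End level_spacing.

(** * The limit at zero and the closed form with [chi_0] *)

Lemma angular_integral_mean (R : realType) (la lb s : R) :
  exists2 c, c \in `[0, pi / 2] &
    angular_integral la lb s = pi / 2 * angular_weight la lb s c.
Proof.
have pi2 : 0 < pi / 2 :> R by rewrite divr_gt0// pi_gt0.
have [c cpi cE] :=
  integral_mean_value pi2 (@continuous_angular_weight _ la lb s).
by exists c => //; rewrite /angular_integral cE subr0.
Qed.

(** By the mean value theorem the ratio is [K] times the weight at some angle [c] in [[0, pi / 2]]
    depending on [s]. Cosine and sine of [c] lie between 0 and 1, which bounds the ratio uniformly
    in [c] and permits a squeeze. *)
Lemma cvg_spacing_formula (R : realType) (la lb : R) : 0 < la -> 0 < lb ->
  spacing_formula la lb s / s @[s --> 0^'+] --> pi * la * lb / 8.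
Proof.
move=> la0 lb0; have pi0 := pi_gt0 R.
pose K : R := pi * la * lb / 8.
have K0 : 0 < K by rewrite /K !mulr_gt0.
apply: (@squeeze_cvgr _ _ _ _
  (fun s : R => K * expR (- (s / 2) * (la + lb))) (fun=> K)).
- near=> s.
  have s0 : 0 < s by near: s; exact: nbhs_right_gt.
  have [c cpi JE] := angular_integral_mean la lb s.
  have -> : spacing_formula la lb s / s = K * angular_weight la lb s c.
    by rewrite spacing_formulaE JE /K; field; rewrite gt_eqF.
  have /andP[c0 c1] : 0 <= c <= pi / 2 by move: cpi; rewrite in_itv.
  have cos0 : 0 <= cos c.
    apply: cos_ge0_pihalf; rewrite c1 andbT (le_trans _ c0)//.
    by rewrite oppr_le0 divr_ge0// ltW.
  have sin0 : 0 <= sin c.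
    apply: sin_ge0_pi; rewrite c0 (le_trans c1)// ler_pdivrMr//.
    by rewrite ler_peMr ?ler1n// ltW.
  have cos1 := cos_le1 c; have sin1 := sin_le1 c.
  rewrite ler_pM2l// ger_pMr// /angular_weight ler_expR.
  rewrite -[X in _ && (_ <= X)]expR0 ler_expR.
  rewrite /angular_exponent !mulNr lerN2 oppr_le0; apply/andP; split.
    by rewrite ler_pM2l ?divr_gt0// lerD// ler_piMr// ltW.
  by rewrite mulr_ge0// ?divr_ge0 ?addr_ge0 ?mulr_ge0// ltW.
- rewrite -[X in _ --> X](_ : K * expR (- (0 / 2) * (la + lb)) = K); last first.
    by rewrite mul0r oppr0 mul0r expR0 mulr1.
  apply: cvg_at_right_filter; apply: cvgM; first exact: cvg_cst.
  apply: continuous_comp; last exact: continuous_expR.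
  apply: cvgM; last exact: cvg_cst.
  by apply: cvgN; apply: cvgM; [exact: cvg_id|exact: cvg_cst].
- exact: cvg_cst.
Unshelve. all: by end_near. Qed.

Theorem mainTheorem8 (R : realType) (d : measure_display)
    (T : measurableType d) (P : probability T R) (la lb : R)
    (a b : {RV P >-> R})
    (la_gt0 : 0 < la) (lb_gt0 : 0 < lb)
    (indep_ab : independent2 P a b)
    (density_a : has_density P a (laplace_density la))
    (density_b : has_density P b (laplace_density lb)) :
  let S := fun w : T => 2 * Num.sqrt (a w ^+ 2 + b w ^+ 2) in
  let phi := atan (la / lb) in
  let Ahat := Num.sqrt (la ^+ 2 + lb ^+ 2) in
  [/\ forall w : T, is_level_spacing (sym_mx (a w) (b w)) (S w),
      has_density P S (spacing_density la lb),
      spacing_formula la lb s / s @[s --> 0^'+] --> pi * la * lb / 8 &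
      forall s : R, 0 < s ->
        exists chi0 : R, phi <= chi0 <= phi + pi / 2 /\
          spacing_formula la lb s =
            pi * la * lb / 8 * s * expR (- (s / 2) * Ahat * sin chi0)].
Proof.
move=> S phi Ahat; split.
- by move=> w; exact: is_level_spacing_sym_mx.
- exact: level_spacing_has_density.
- exact: cvg_spacing_formula.
- move=> s s0; have [c + JE] := angular_integral_mean la lb s.
  rewrite in_itv/= => /andP[c0 c1].
  (* The mean value angle [c], shifted by the phase [phi] of the sine wave. *)
  exists (c + phi); split.
    by rewrite lerDr c0 addrC lerD2l.
  rewrite spacing_formulaE JE /angular_weight angular_exponentE// -/phi -/Ahat.
  by rewrite -[X in _ = _ * expR X]mulrA; field.
Qed.
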